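(* Let $A\ge1$ and let $a_{jk}\in\overline{K}_c$ ($j\ge0$, $k\ge0$) satisfy $|a_{jk}|\le A^{kq^j}$ for $k\ge1$ and $|a_{j0}|\le A^{q^j}$. Consider the equation $$dz(t)=\sum_{j=0}^\infty\sum_{k=1}^\infty a_{jk}\,\tau^j\underbrace{(z\circ z\circ\cdots\circ z)}_{k}(t)+\sum_{j=0}^\infty a_{j0}t^{q^j}.$$ Then there exists a solution of the form $z(t)=\sum_{k=1}^\infty c_kt^{q^k}$, $c_k\in\overline{K}_c$, whose series has a non-zero radius of convergence, and such a solution is unique.
   Context: $q=p^\upsilon$ with $p$ prime, $\upsilon\ge1$. $K=\mathbb F_q((x))$ with absolute value $|\sum_{j\ge N}\xi_jx^j|=q^{-N}$ ($\xi_N\ne0$), so $|x|=q^{-1}$; $\overline{K}_c$ is the completion of an algebraic closure of $K$ with the extended absolute value. $\tau$ is the operator $\tau u=u^q$, so $\tau^j u=u^{q^j}$. The Carlitz derivative is $d=\sqrt[q]{\ }\circ\Delta$, where $(\Delta u)(t)=u(xt)-xu(t)$; thus $d\big(ct^{q^k}\big)=c^{1/q}[k]^{1/q}t^{q^{k-1}}$ with $[k]=x^{q^k}-x$. $z\circ z\circ\cdots\circ z$ denotes the $k$-fold composition of $z$ with itself. *)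

(* Defs.v *)
From HB Require Import structures.
From mathcomp Require Import all_boot all_order all_algebra.
From mathcomp Require Import zify.
From mathcomp Require Import all_classical all_reals all_analysis.
Set Implicit Arguments.
Unset Strict Implicit.
Unset Printing Implicit Defensive.
Import Order.TTheory GRing.Theory Num.Theory.
Import numFieldNormedType.Exports.
Local Open Scope classical_set_scope.
Local Open Scope ring_scope.

Section Laurent.
Variable F : fieldType.

Record laurent := Laurent {
  lcoef :> int -> F;
  _ : exists N : int, forall n, n < N -> lcoef n = 0 }.

HB.instance Definition _ := gen_eqMixin laurent.
HB.instance Definition _ := gen_choiceMixin laurent.

Implicit Types f g h : laurent.

Lemma laurent_bound f : exists N : int, forall n, n < N -> f n = 0.
Proof. by case: f. Qed.

Lemma laurentP f g : lcoef f =1 lcoef g -> f = g.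
Proof.
case: f => f pf; case: g => g pg /= /funext fg; case: _ / fg in pg *.
by congr Laurent; apply: Prop_irrelevance.
Qed.

(* [lsingle c k] is the monomial [c * x ^ k]. *)
Fact lsingle_subproof (c : F) (k : int) :
  exists N : int, forall n, n < N -> (if n == k then c else 0) = 0.
Proof. by exists k => n; case: eqVneq => // ->; rewrite ltxx. Qed.
Definition lsingle c k := Laurent (lsingle_subproof c k).

Fact ladd_subproof f g :
  exists N : int, forall n, n < N -> f n + g n = 0.
Proof.
have [M fM] := laurent_bound f; have [N gN] := laurent_bound g.
exists (Num.min M N) => n; rewrite lt_min => /andP[nM nN].
by rewrite fM// gN// addr0.
Qed.
Definition ladd f g := Laurent (ladd_subproof f g).

Fact lopp_subproof f : exists N : int, forall n, n < N -> - f n = 0.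
Proof.
by have [M fM] := laurent_bound f; exists M => n /fM ->; rewrite oppr0.
Qed.
Definition lopp f := Laurent (lopp_subproof f).

(* Cauchy product; the sum over Z has finite support. *)
Definition lmul_coef (f g : int -> F) (n : int) : F :=
  \sum_(i \in [set: int]) f i * g (n - i).

Lemma lmul_coef_lt f g (M N : int) :
  (forall n, n < M -> f n = 0) -> (forall n, n < N -> g n = 0) ->
  forall n, n < M + N -> lmul_coef f g n = 0.
Proof.
move=> fM gN n nMN; apply: fsbig1 => i _.
have [iM|Mi] := ltP i M; first by rewrite fM// mul0r.
by rewrite (gN (n - i)) ?mulr0//; lia.
Qed.

Fact lmul_subproof f g :
  exists N : int, forall n, n < N -> lmul_coef f g n = 0.
Proof.
have [M fM] := laurent_bound f; have [N gN] := laurent_bound g.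
by exists (M + N); apply: lmul_coef_lt.
Qed.
Definition lmul f g := Laurent (lmul_subproof f g).

Let tr (f : int -> F) (M : int) (d : nat) : {poly F} :=
  \poly_(i < d) f (M + i%:Z).

Let lmulE f g (M N : int) (d m : nat) :
  (forall n, n < M -> f n = 0) -> (forall n, n < N -> g n = 0) ->
  (m < d)%N -> lmul f g (M + N + m%:Z) = (tr f M d * tr g N d)`_m.
Proof.
move=> fM gN md; rewrite coefM /= /lmul_coef.
rewrite -(fsbig_widen [set M + i%:Z | i in `I_m.+1]) //=; last first.
  move=> i /= [_ /= nI].
  have [iM|Mi] := ltP i M; first by rewrite fM// mul0r.
  rewrite (gN (M + N + m - i)) ?mulr0//.
  rewrite ltNge; apply/negP => ge; apply: nI.
  exists `|i - M|%N; lia.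
rewrite fsbig_image; last by move=> a b _ _ /addrI [].
rewrite -fsbig_ord; apply: eq_bigr => i _ /=.
rewrite !coef_poly.
have := ltn_ord i => im.
do 2 (case: ltnP => [_|]; last by lia).
congr (_ * g _); lia.
Qed.

Let coefM_eq (p p' r : {poly F}) m :
  (forall i, (i <= m)%N -> p`_i = p'`_i) -> (p * r)`_m = (p' * r)`_m.
Proof.
move=> pp'; rewrite !coefM; apply: eq_bigr => i _; rewrite pp'//.
by have := ltn_ord i; rewrite ltnS.
Qed.

Let trM f g (M N : int) (d i : nat) :
  (forall n, n < M -> f n = 0) -> (forall n, n < N -> g n = 0) ->
  (i < d)%N -> (tr (lmul f g) (M + N) d)`_i = (tr f M d * tr g N d)`_i.
Proof. by move=> fM gN id; rewrite coef_poly id; apply: lmulE. Qed.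

Let int_cases (M n : int) : n < M \/ exists m : nat, n = M + m%:Z.
Proof.
have [|Mn] := ltP n M; first by left.
by right; exists `|n - M|%N; lia.
Qed.

Fact laddA : associative ladd.
Proof. by move=> f g h; apply: laurentP => n /=; rewrite addrA. Qed.
Fact laddC : commutative ladd.
Proof. by move=> f g; apply: laurentP => n /=; rewrite addrC. Qed.
Fact ladd0 : left_id (lsingle 0 0) ladd.
Proof. by move=> f; apply: laurentP => n /=; rewrite if_same add0r. Qed.
Fact laddN : left_inverse (lsingle 0 0) lopp ladd.
Proof. by move=> f; apply: laurentP => n /=; rewrite if_same addNr. Qed.

HB.instance Definition _ :=
  GRing.isZmodule.Build laurent laddA laddC ladd0 laddN.

Fact lmulC : commutative lmul.
Proof.
move=> f g; apply: laurentP => n.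
have [M fM] := laurent_bound f; have [N gN] := laurent_bound g.
have [nMN|[m ->]] := int_cases (M + N) n.
  by rewrite /= (lmul_coef_lt fM gN)// (lmul_coef_lt gN fM)// addrC.
by rewrite (lmulE fM gN (ltnSn m)) mulrC -(lmulE gN fM (ltnSn m)) (addrC M).
Qed.

Fact lmulA : associative lmul.
Proof.
move=> f g h; apply: laurentP => n.
have [M fM] := laurent_bound f; have [N gN] := laurent_bound g.
have [P hP] := laurent_bound h.
have fg : forall n, n < M + N -> lmul f g n = 0 by exact: lmul_coef_lt.
have gh : forall n, n < N + P -> lmul g h n = 0 by exact: lmul_coef_lt.
have [nMN|[m ->]] := int_cases (M + N + P) n.
  by rewrite /= (lmul_coef_lt fM gh) ?(lmul_coef_lt fg hP)// addrA.
rewrite (lmulE fg hP (ltnSn m)).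
rewrite (coefM_eq (p' := tr f M m.+1 * tr g N m.+1)); last first.
  by move=> i im; apply: trM.
rewrite -{1}(addrA M) (lmulE fM gh (ltnSn m)) mulrC.
rewrite (coefM_eq (p := tr (lmul g h) _ _)
  (p' := tr g N m.+1 * tr h P m.+1)); last first.
  by move=> i im; apply: trM.
by rewrite mulrC mulrA.
Qed.

Fact lmul1 : left_id (lsingle 1 0) lmul.
Proof.
move=> f; apply: laurentP => n; have [N fN] := laurent_bound f.
have s0 : forall n : int, n < 0 -> lsingle 1 0 n = 0.
  by move=> k; rewrite /=; case: eqVneq => // ->; rewrite ltxx.
have [nN|[m ->]] := int_cases N n.
  by rewrite /= (lmul_coef_lt s0 fN) ?add0r// fN.
rewrite -{1}(add0r N) (lmulE s0 fN (ltnSn m)).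
suff -> : tr (lsingle 1 0) 0 m.+1 = 1 by rewrite mul1r coef_poly ltnSn.
apply/polyP => i; rewrite coef_poly coef1 add0r /=.
by case: i => [|i] //=; rewrite if_same.
Qed.

Fact lmulDl : left_distributive lmul ladd.
Proof.
move=> f g h; apply: laurentP => n.
have [M1 fM1] := laurent_bound f; have [M2 gM2] := laurent_bound g.
have [P hP] := laurent_bound h.
pose M := Num.min M1 M2.
have fM : forall n, n < M -> f n = 0.
  by move=> k; rewrite lt_min => /andP[+ _]; apply: fM1.
have gM : forall n, n < M -> g n = 0.
  by move=> k; rewrite lt_min => /andP[_]; apply: gM2.
have fgM : forall n, n < M -> ladd f g n = 0.
  by move=> k kM /=; rewrite fM// gM// addr0.
have [nM|[m ->]] := int_cases (M + P) n.
  rewrite /= (lmul_coef_lt fM hP)// (lmul_coef_lt gM hP)//.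
  by rewrite (lmul_coef_lt fgM hP)// addr0.
rewrite (lmulE fgM hP (ltnSn m)).
transitivity (lmul f h (M + P + m%:Z) + lmul g h (M + P + m%:Z)) => //.
rewrite (lmulE fM hP (ltnSn m)) (lmulE gM hP (ltnSn m)) -coefD -mulrDl.
congr (nth _ (polyseq (_ * _)) _); apply/polyP => i.
by rewrite coefD !coef_poly; case: ifP => //; rewrite addr0.
Qed.

Fact lone_neq0 : lsingle 1 0 != 0 :> laurent.
Proof.
apply/eqP => /(congr1 (fun f : laurent => f 0)) /=.
by move/eqP; rewrite oner_eq0.
Qed.

HB.instance Definition _ :=
  GRing.Zmodule_isComNzRing.Build laurent lmulA lmulC lmul1 lmulDl lone_neq0.

Let is_order f (N : int) := f N != 0 /\ forall n, n < N -> f n = 0.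

Let order_exists f : f != 0 -> exists N, is_order f N.
Proof.
move=> f0; have [M fM] := laurent_bound f.
have ex : exists m : nat, f (M + m%:Z) != 0.
  apply: contrapT => /forallNP all0; move/negP: f0; apply; apply/eqP.
  apply: laurentP => n; rewrite /= if_same.
  have [/fM//|[m ->]] := int_cases M n.
  by have /negP/negPn/eqP := all0 m.
exists (M + (ex_minn ex)%:Z); case: ex_minnP => m fm mmin; split=> // n nm.
have [/fM//|[k nk]] := int_cases M n.
apply/eqP; apply: contraTT nm => fn; rewrite nk -leNgt lerD2l lez_nat.
by apply: mmin; rewrite -nk.
Qed.

Let lmulV_exists f : f != 0 -> exists g, g * f = 1.
Proof.
move=> /order_exists [M [fM0 fM]].
pose c := (f M)^-1.
pose h d : {poly F} := 1 - c *: tr f M d.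
have h0 d : (h d.+1)`_0 = 0.
  by rewrite coefB coef1 coefZ coef_poly /= addr0 mulVf// subrr.
have hX d : exists r, h d.+1 = r * 'X.
  have /factor_theorem : root (h d.+1) 0 by rewrite /root horner_coef0 h0.
  by rewrite subr0.
pose w d : {poly F} := c *: \sum_(i < d) h d ^+ i.
have wE d : w d * tr f M d = 1 - h d ^+ d.
  have -> : w d * tr f M d = (1 - h d) * \sum_(i < d) h d ^+ i.
    have -> : 1 - h d = c *: tr f M d by rewrite /h subKr.
    by rewrite /w -!scalerAl mulrC.
  by rewrite -[RHS]opprB subrX1 -mulNr (opprB (h d)).
have wV d i : (i < d)%N -> (w d * tr f M d)`_i = (i == 0)%N%:R.
  case: d => // d id; rewrite wE coefB coef1.
  have [r ->] := hX d; rewrite exprMn coefMXn id subr0 //.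
have trE d e i : (i < d)%N -> (i < e)%N -> (tr f M d)`_i = (tr f M e)`_i.
  by move=> id ie; rewrite !coef_poly id ie.
have wuniq d e i : (i < d)%N -> (d <= e)%N -> (w d)`_i = (w e)`_i.
  move=> id de.
  have E (p : {poly F}) : (forall k, (k <= i)%N -> p`_k = (k == 0)%N%:R) ->
      forall r : {poly F}, (p * r)`_i = r`_i.
    move=> pE r; rewrite (coefM_eq (p' := 1)) ?mul1r// => k ki.
    by rewrite pE// coef1.
  transitivity ((tr f M e * (w d * w e))`_i).
    rewrite [w d * _]mulrC mulrA [tr _ _ _ * _]mulrC E// => k ki.
    by apply: wV; lia.
  rewrite (coefM_eq (p' := tr f M d)); last by move=> k ki; apply: trE; lia.
  rewrite mulrA [tr _ _ _ * _]mulrC E// => k ki.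
  by apply: wV; lia.
have gP : exists N : int, forall n, n < N ->
    (if n < - M then 0 else (w `|(n + M)%R|.+1)`_`|(n + M)%R|) = 0.
  by exists (- M) => n ->.
pose g := Laurent gP.
have gM : forall n, n < - M -> g n = 0 by move=> n nM /=; rewrite nM.
exists g; apply: laurentP => n.
have [nM|[m ->]] := int_cases (- M + M) n.
  rewrite /= (lmul_coef_lt gM fM)//; case: eqP => // n0; lia.
rewrite (lmulE gM fM (ltnSn m)).
rewrite (coefM_eq (p' := w m.+1)); last first.
  move=> i im; rewrite coef_poly ltnS im /=.
  case: ifP => [|_]; first lia.
  have -> : `|(- M + i%:Z + M)%R|%N = i by lia.
  by apply: wuniq; lia.
rewrite wV// addNr add0r /=.
by case: m.
Qed.

Definition linv f : laurent := xget 0 [set g | f != 0 /\ g * f = 1].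

Fact lmulV f : f != 0 -> linv f * f = 1.
Proof.
move=> f0; have [g gf] := lmulV_exists f0.
by have [|] := @xgetPex _ 0 [set g | f != 0 /\ g * f = 1]; first by exists g.
Qed.

Fact linv0 : linv 0 = 0.
Proof. by rewrite /linv; case: xgetP => // g _ []; rewrite eqxx. Qed.

HB.instance Definition _ := GRing.ComNzRing_isField.Build laurent lmulV linv0.

(* The exponent of the lowest nonzero coefficient (junk value 0 at f = 0). *)
Definition lorder f : int :=
  xget 0 [set N : int | f N != 0 /\ forall n, n < N -> f n = 0].

Lemma lorderP f : f != 0 ->
  f (lorder f) != 0 /\ forall n, n < lorder f -> f n = 0.
Proof.
move=> /order_exists [N fN]; apply: (@xgetPex _ 0 [set N | is_order f N]).
by exists N.
Qed.

End Laurent.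

Section AbsoluteValues.
Variable R : realType.

Definition labs (F : finFieldType) (f : laurent F) : R :=
  if f == 0 then 0 else #|F|%:R ^ (- lorder f).

Definition nonarch_absval (L : fieldType) (v : L -> R) : Prop :=
  [/\ forall a, 0 <= v a,
      forall a, v a = 0 <-> a = 0,
      forall a b, v (a * b) = v a * v b
    & forall a b, v (a + b) <= Num.max (v a) (v b)].

Definition algebraic_closure (K : fieldType) (L : closedFieldType)
    (i : {rmorphism K -> L}) : Prop :=
  forall y : L, algebraicOver i y.

Definition abs_cvg (C : fieldType) (v : C -> R) (s : nat -> C) (l : C) : Prop :=
  v (s n - l) @[n --> \oo] --> (0 : R).

Definition abs_cauchy (C : fieldType) (v : C -> R) (s : nat -> C) : Prop :=
  forall e : R, 0 < e ->
    exists N, forall m n, (N <= m)%N -> (N <= n)%N -> v (s m - s n) < e.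

Definition completion (L C : fieldType) (vL : L -> R) (vC : C -> R)
    (i : {rmorphism L -> C}) : Prop :=
  [/\ forall a, vC (i a) = vL a,
      forall (y : C) (e : R), 0 < e -> exists a, vC (y - i a) < e
    & forall s, abs_cauchy vC s -> exists l, abs_cvg vC s l].

Definition is_sum (C : fieldType) (v : C -> R) (f : nat -> C) (s : C) : Prop :=
  abs_cvg v (fun n => \sum_(k < n) f k) s.

End AbsoluteValues.

Section Carlitz.
Variables (R : realType) (C : fieldType) (v : C -> R) (q : nat).

(* In a field of characteristic p, with q a power of p, [u] has at most one
   q-th root; the value 0 at elements without root is junk. *)
Definition qroot (u : C) : C := xget 0 [set w : C | w ^+ q = u].

Definition tau (u : C -> C) : C -> C := fun t => u t ^+ q.

Definition carlitz_Delta (x : C) (u : C -> C) : C -> C :=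
  fun t => u (x * t) - x * u t.

Definition carlitz_d (x : C) (u : C -> C) : C -> C :=
  fun t => qroot (carlitz_Delta x u t).

(* Evaluation of the series [\sum_(k >= 0) c k * t ^+ (q ^ k)], with junk value
   0 where it diverges. *)
Definition fqseries (c : nat -> C) : C -> C :=
  fun t => xget 0 [set s : C | is_sum v (fun k => c k * t ^+ (q ^ k)) s].

Definition positive_radius (c : nat -> C) : Prop :=
  exists2 r : R, 0 < r & forall t, v t < r ->
    exists s, is_sum v (fun k => c k * t ^+ (q ^ k)) s.

(* The equation is an identity between functions on some disc around 0 (on a
   large disc neither the compositions nor the right-hand side need converge).
   If [z = fqseries c] with [c 0 = 0] and [positive_radius c], then [z] maps every
   sufficiently small disc into itself, so shrinking [r] keeps all the iterates
   in the domain of convergence, away from the junk values of [fqseries]. *)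
Definition carlitz_solution (x : C) (a : nat -> nat -> C) (z : C -> C) : Prop :=
  exists2 r : R, 0 < r & forall t, v t < r ->
    exists (b : nat -> C) (S S0 : C),
      [/\ forall j,
            is_sum v (fun k => a j k.+1 * iter j tau (iter k.+1 z) t) (b j),
          is_sum v b S,
          is_sum v (fun j => a j 0%N * t ^+ (q ^ j)) S0
        & carlitz_d x z t = S + S0].

End Carlitz.

(* Main.v *)
Require Import Defs.
From mathcomp Require Import all_boot all_order all_algebra.
From mathcomp Require Import all_classical all_reals all_analysis.
From mathcomp Require Import finfield.
From mathcomp Require Import ring zify.
Set Implicit Arguments.
Unset Strict Implicit.
Unset Printing Implicit Defensive.
Import Order.TTheory GRing.Theory Num.Theory.
Import numFieldNormedType.Exports.
Local Open Scope ring_scope.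

(** Substituting [z = \sum_(k >= 1) c k * t ^+ (q ^ k)] turns the equation into
    [c n.+1 * (x ^+ (q ^ n.+1) - x) = e n ^+ q], where [e n], the coefficient of
    [t ^+ (q ^ n)] on the right-hand side, involves [c l] for [l <= n] only;
    this determines [c] uniquely.  The estimate [A * |c l| <= B ^ (q ^ l - 1)]
    propagates to [A ^ k * |Z k m| <= B ^ (q ^ m - 1)] for the coefficients [Z k m]
    of the [k]-fold composition, and [B = A ^ 3 / |x|] makes the recursion
    preserve it.  The same estimate, with some other [B], holds for every series
    of positive radius, and it legitimates the rearrangement of the multiple
    series, since all the double series are triangular and geometrically small.
    Extracting [q]-th roots needs [C] to be perfect, which it inherits from the
    dense algebraically closed subfield. *)

(** * Convergence of sequences and series for a non-archimedean absolute value *)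

Lemma expr_geometric_small (R : realType) (th e : R) : 0 <= th < 1 -> 0 < e ->
  exists N, forall n, (N <= n)%N -> th ^+ n < e.
Proof.
move=> /andP[th0 th1] e0.
have /cvgrPdist_lt /(_ e e0) : (th ^+ n @[n --> \oo] --> (0 : R))%classic.
  by apply: cvg_expr; rewrite ger0_norm.
case=> N _ H; exists N => n /H /=.
by rewrite sub0r normrN ger0_norm// exprn_ge0.
Qed.

Section NonarchAbsval.
Variables (R : realType) (C : fieldType) (v : C -> R).
Hypothesis hv : nonarch_absval v.

Lemma absval_ge0 a : 0 <= v a.
Proof. by case: hv. Qed.
Hint Resolve absval_ge0 : core.

Lemma absval_eq0 a : (v a == 0) = (a == 0).
Proof. by case: hv => _ h _ _; apply/eqP/eqP => /h. Qed.

Lemma absval0 : v 0 = 0.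
Proof. by apply/eqP; rewrite absval_eq0. Qed.

Lemma absval_gt0 a : (0 < v a) = (a != 0).
Proof. by rewrite lt_def absval_eq0 absval_ge0 andbT. Qed.

Lemma absvalM a b : v (a * b) = v a * v b.
Proof. by case: hv. Qed.

Lemma absval1 : v 1 = 1.
Proof.
have v1 : v 1 != 0 by rewrite absval_eq0 oner_eq0.
by apply: (mulfI v1); rewrite -absvalM !mulr1.
Qed.

Lemma absvalX a n : v (a ^+ n) = v a ^+ n.
Proof. by elim: n => [|n IHn]; rewrite ?expr0 ?absval1// !exprS absvalM IHn. Qed.

Lemma absvalN a : v (- a) = v a.
Proof.
apply/eqP; rewrite -(@eqrXn2 _ 2)//.
by rewrite -!absvalX sqrrN.
Qed.

Lemma absvalD_le a b M : v a <= M -> v b <= M -> v (a + b) <= M.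
Proof.
move=> aM bM; case: hv => _ _ _ /(_ a b) h.
by apply: le_trans h _; rewrite ge_max aM.
Qed.

Lemma absvalB_le a b M : v a <= M -> v b <= M -> v (a - b) <= M.
Proof. by move=> aM bM; apply: absvalD_le => //; rewrite absvalN. Qed.

Lemma absvalD_lt a b M : v a < M -> v b < M -> v (a + b) < M.
Proof.
move=> aM bM; case: hv => _ _ _ /(_ a b) h.
by apply: le_lt_trans h _; rewrite gt_max aM.
Qed.

Lemma absval_distC a b : v (a - b) = v (b - a).
Proof. by rewrite -opprB absvalN. Qed.

Lemma absval_sum_le (I : Type) (r : seq I) (P : pred I) (F : I -> C) M :
  0 <= M -> (forall i, P i -> v (F i) <= M) -> v (\sum_(i <- r | P i) F i) <= M.
Proof.
move=> M0 FM; elim/big_rec: _ => [|i y Pi yM]; first by rewrite absval0.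
by apply: absvalD_le => //; apply: FM.
Qed.

(** Isosceles triangle principle: a smaller value of [a + b] would make [a = (a + b) - b] smaller
    than itself. *)
Lemma absvalD_eq a b : v b < v a -> v (a + b) = v a.
Proof.
move=> ba; apply/eqP; rewrite eq_le absvalD_le//=; last exact: ltW.
rewrite leNgt; apply/negP => ab.
have : v (a + b - b) < v a by apply: absvalD_lt => //; rewrite absvalN.
by rewrite addrK ltxx.
Qed.

Lemma abs_cvgP s l : abs_cvg v s l <->
  forall e, 0 < e -> exists N, forall n, (N <= n)%N -> v (s n - l) < e.
Proof.
split=> [/cvgrPdist_lt h e /h [N _ hN]|h].
  by exists N => n /hN /=; rewrite sub0r normrN ger0_norm.
apply/cvgrPdist_lt => e /h [N hN].
by exists N => // n /hN /=; rewrite sub0r normrN ger0_norm.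
Qed.

(** Closed balls are closed: a late term of [s] closer to [l] than [v (l - b)] and within [M] of [b]
    would violate the ultrametric inequality. *)
Lemma abs_cvg_dist_le s l b M N : abs_cvg v s l ->
  (forall n, (N <= n)%N -> v (s n - b) <= M) -> v (l - b) <= M.
Proof.
move=> /abs_cvgP sl sM; rewrite leNgt; apply/negP => Ml.
have M0 : 0 <= M by apply: le_trans (sM N (leqnn N)).
have [N' /(_ (maxn N N') (leq_maxr _ _)) h] := sl _ (le_lt_trans M0 Ml).
have := le_lt_trans (sM _ (leq_maxl N N')) Ml => h'.
have : v ((s (maxn N N') - b) + (l - s (maxn N N'))) < v (l - b).
  by apply: absvalD_lt => //; rewrite absval_distC.
by rewrite addrC addrA subrK ltxx.
Qed.

Lemma abs_cvg_unique s l l' : abs_cvg v s l -> abs_cvg v s l' -> l = l'.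
Proof.
move=> sl /abs_cvgP sl'; apply/eqP; rewrite -subr_eq0 -absval_eq0 eq_le absval_ge0.
rewrite andbT; apply/ler_addgt0Pr => e e0; rewrite add0r.
have [N hN] := sl' e e0.
by apply: (abs_cvg_dist_le (N := N) sl) => n /hN /ltW.
Qed.

Lemma abs_cvg_near s s' l : abs_cvg v s l ->
  abs_cvg v (fun n => s' n - s n) 0 -> abs_cvg v s' l.
Proof.
move=> /abs_cvgP sl /abs_cvgP h; apply/abs_cvgP => e e0.
have [N hN] := sl e e0; have [N' hN'] := h e e0.
exists (maxn N N') => n; rewrite geq_max => /andP[/hN h1 /hN' h2].
have -> : s' n - l = (s' n - s n - 0) + (s n - l) by ring.
exact: absvalD_lt.
Qed.

Lemma abs_cvg0_geometric (th : R) s : 0 <= th < 1 ->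
  (forall n, v (s n) <= th ^+ n) -> abs_cvg v s 0.
Proof.
move=> th1 sth; apply/abs_cvgP => e e0.
have [N hN] := expr_geometric_small th1 e0.
by exists N => n /hN; rewrite subr0; apply: le_lt_trans.
Qed.

Lemma is_sum_unique f s u : is_sum v f s -> is_sum v f u -> s = u.
Proof. exact: abs_cvg_unique. Qed.

Lemma eq_is_sum f g s : f =1 g -> is_sum v f s -> is_sum v g s.
Proof. by move=> /funext ->. Qed.

Lemma is_sumD f g s u : is_sum v f s -> is_sum v g u ->
  is_sum v (fun n => f n + g n) (s + u).
Proof.
move=> /abs_cvgP fs /abs_cvgP gu; apply/abs_cvgP => e e0.
have [N hN] := fs e e0; have [N' hN'] := gu e e0.
exists (maxn N N') => n; rewrite geq_max => /andP[/hN h1 /hN' h2].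
by rewrite big_split /= opprD addrACA; apply: absvalD_lt.
Qed.

Lemma is_sumZ a f s : is_sum v f s -> is_sum v (fun n => a * f n) (a * s).
Proof.
move=> /abs_cvgP fs; apply/abs_cvgP => e e0.
have [N hN] := fs _ (divr_gt0 e0 (ltr_pwDr ltr01 (absval_ge0 a))).
exists N => n /hN h; rewrite -mulr_sumr -mulrBr absvalM.
rewrite ltr_pdivlMr in h; last by rewrite ltr_wpDl.
by apply: le_lt_trans h; rewrite mulrC ler_wpM2l// lerDl.
Qed.

Lemma is_sumB f g s u : is_sum v f s -> is_sum v g u ->
  is_sum v (fun n => f n - g n) (s - u).
Proof.
move=> fs gu; rewrite -[- u]mulN1r.
by apply: eq_is_sum (is_sumD fs (is_sumZ (-1) gu)) => n; rewrite mulN1r.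
Qed.

Lemma is_sum_shift l f s : is_sum v f s ->
  is_sum v (fun n => if (l <= n)%N then f (n - l)%N else 0) s.
Proof.
move=> /abs_cvgP fs; apply/abs_cvgP => e /fs [N hN].
exists (l + N)%N => n lNn.
rewrite -(subnKC (leq_trans (leq_addr N l) lNn)) big_split_ord /=.
rewrite big1 ?add0r; last first.
  by move=> i _; rewrite leqNgt ltn_ord.
rewrite (eq_bigr (fun i : 'I_(n - l) => f i)); last first.
  by move=> i _; rewrite leq_addr addKn.
by apply: hN; lia.
Qed.

Lemma is_sum_tail f s N M : is_sum v f s ->
  (forall n, (N <= n)%N -> v (f n) <= M) -> v (s - \sum_(k < N) f k) <= M.
Proof.
move=> fs fM; have M0 : 0 <= M by apply: le_trans (fM N (leqnn N)).
apply: (abs_cvg_dist_le (N := N) fs) => n Nn.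
rewrite -(subnKC Nn) big_split_ord /= addrAC subrr add0r.
by apply: absval_sum_le => // i _; apply: fM; rewrite leq_addr.
Qed.

Lemma is_sum_single (a : C) : is_sum v (fun n => if n == 0%N then a else 0) a.
Proof.
apply/abs_cvgP => e e0; exists 1%N => -[//|n] _.
by rewrite big_ord_recl /= big1// addr0 subrr absval0.
Qed.

(** Each term is a difference of consecutive partial sums, so late terms are below 1; the finitely
    many early ones are absorbed by adding up their absolute values. *)
Lemma is_sum_terms_bounded f s : is_sum v f s ->
  exists2 M, 1 <= M & forall n, v (f n) <= M.
Proof.
move=> /abs_cvgP fs; have [N hN] := fs 1 ltr01.
exists (1 + \sum_(i < N) v (f i)); first by rewrite lerDl sumr_ge0.
move=> n; have [nN|Nn] := ltnP n N.
  rewrite (bigD1 (Ordinal nN)) //= addrCA lerDl addr_ge0//.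
  by rewrite sumr_ge0.
apply: (@le_trans _ _ 1); last by rewrite lerDl sumr_ge0.
have -> : f n = (\sum_(k < n.+1) f k - s) + (s - \sum_(k < n) f k).
  by rewrite big_ord_recr /=; ring.
by apply/ltW/absvalD_lt; [|rewrite absval_distC]; apply: hN => //; apply: leqW.
Qed.

(** Rearrangement of a double series from summation along columns to summation of the row sums
    [s l]. After [n] steps the two partial sums differ only by the tails from [n] on of the rows
    [l < n], and the ultrametric inequality bounds their total by [th ^+ n], however many rows there
    are. Convergence of [s] is part of the conclusion. *)
Lemma is_sum_triangular (th : R) (G : nat -> nat -> C) (s : nat -> C) S :
  0 <= th < 1 -> (forall l n, v (G l n) <= th ^+ n) ->
  (forall l n, (n < l)%N -> G l n = 0) ->
  (forall l, is_sum v (G l) (s l)) ->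
  is_sum v (fun n => \sum_(l < n.+1) G l n) S -> is_sum v s S.
Proof.
move=> th1 Gth G0 Gs; have /andP[th0 th1'] := th1.
move=> /abs_cvg_near; apply; apply: (abs_cvg0_geometric th1) => n.
(* The triangle is completed to a square, since the added entries [G l k] with [k < l] vanish. *)
have -> : \sum_(k < n) \sum_(l < k.+1) G l k = \sum_(l < n) \sum_(k < n) G l k.
  rewrite exchange_big /=; apply: eq_bigr => k _.
  rewrite -!(big_mkord xpredT (fun l => G l k)).
  rewrite (big_cat_nat (n := k.+1) _ (ltn_ord k))//= [X in _ = _ + X]big_nat_cond.
  rewrite [X in _ + X]big1 ?addr0// => l.
  by rewrite andbT => /andP[kl _]; rewrite G0.
rewrite -sumrB; apply: absval_sum_le => [|i _]; first exact: exprn_ge0.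
apply: is_sum_tail => [|m nm]; first exact: Gs.
by apply: le_trans (Gth _ _) _; rewrite ler_wiXn2l// ltW.
Qed.

Lemma is_sum_geometric (th : R) f :
  (forall s, abs_cauchy v s -> exists l, abs_cvg v s l) ->
  0 <= th < 1 -> (forall n, v (f n) <= th ^+ n) -> exists s, is_sum v f s.
Proof.
move=> complete th1 fth; apply: complete => e e0.
have [N hN] := expr_geometric_small th1 e0; exists N => m n.
have /andP[th0 th1'] := th1.
wlog mn : m n / (m <= n)%N.
  move=> h Nm Nn; case: (leqP m n) => mn; first exact: h.
  by rewrite absval_distC; apply: h => //; apply: ltnW.
move=> Nm _; rewrite absval_distC -(subnKC mn) big_split_ord /= addrAC subrr add0r.
apply: le_lt_trans (hN m Nm); apply: absval_sum_le => [|i _].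
  exact: exprn_ge0.
apply: le_trans (fth _) _; rewrite ler_wiXn2l//; [exact: ltW|exact: leq_addr].
Qed.

End NonarchAbsval.

(** Course-of-values recursion: [approx n] is already correct at the indices below [n], and the
    solution reads off the diagonal [approx n.+1 n]. By locality of [F] the filler [x0] has no
    influence. *)
Lemma fun_rec_exists (T : Type) (x0 : T) (F : nat -> (nat -> T) -> T) :
  (forall n f g, (forall i, (i < n)%N -> f i = g i) -> F n f = F n g) ->
  exists f, forall n, f n = F n f.
Proof.
move=> Floc.
pose approx := fix approx n := if n is m.+1
  then fun i => if i == m then F m (approx m) else approx m i else fun=> x0.
have approxE m : forall n i, (i < n)%N -> (n <= m)%N -> approx m i = approx n i.
  elim: m => [|m IHm] n i iln; first by rewrite leqn0 => /eqP n0; lia.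
  rewrite leq_eqVlt => /orP[/eqP -> //|]; rewrite ltnS => nm /=.
  by case: eqP => [|_]; [lia|apply: IHm].
exists (fun n => approx n.+1 n) => n /=; rewrite eqxx.
by apply: Floc => i ilt; exact: (approxE n i.+1 i).
Qed.

(** * Series in the powers [t ^+ (q ^ n)] and their compositions *)

Section LinearizedSeries.
Variables (R : realType) (C : fieldType) (v : C -> R) (q : nat).
Hypothesis hv : nonarch_absval v.
Hypothesis complete : forall s, abs_cauchy v s -> exists l, abs_cvg v s l.
Hypothesis q_gt1 : (1 < q)%N.
Hypothesis exprqD : forall a b : C, (a + b) ^+ q = a ^+ q + b ^+ q.

Let v_ge0 a : 0 <= v a. Proof. exact: absval_ge0. Qed.
Hint Resolve v_ge0 : core.
Let qn_gt0 n : (0 < q ^ n)%N. Proof. by rewrite expn_gt0 (ltnW q_gt1). Qed.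
Hint Resolve qn_gt0 : core.

Lemma exprqXD n (a b : C) : (a + b) ^+ (q ^ n) = a ^+ (q ^ n) + b ^+ (q ^ n).
Proof. by elim: n => [|n IHn] //; rewrite expnSr !exprM IHn exprqD. Qed.

Lemma expr0qX n : 0 ^+ (q ^ n) = 0 :> C.
Proof. by rewrite expr0n; case: eqP => // h; have := qn_gt0 n; rewrite h. Qed.

Lemma exprqXN n (a : C) : (- a) ^+ (q ^ n) = - a ^+ (q ^ n).
Proof.
by apply/eqP; rewrite -addr_eq0 -exprqXD addNr expr0qX.
Qed.

Lemma exprqXB n (a b : C) : (a - b) ^+ (q ^ n) = a ^+ (q ^ n) - b ^+ (q ^ n).
Proof. by rewrite exprqXD exprqXN. Qed.

Lemma exprqX_sum n (I : Type) (r : seq I) (P : pred I) (F : I -> C) :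
  (\sum_(i <- r | P i) F i) ^+ (q ^ n) = \sum_(i <- r | P i) F i ^+ (q ^ n).
Proof.
elim: r => [|i r IHr]; first by rewrite !big_nil expr0qX.
by rewrite !big_cons; case: ifP => // _; rewrite exprqXD IHr.
Qed.

Lemma exprq_inj : injective (fun a : C => a ^+ q).
Proof.
move=> a b /= /eqP; rewrite -[q]expn1 -subr_eq0 -exprqXB expf_eq0 => /andP[_].
by rewrite subr_eq0 => /eqP.
Qed.

Lemma is_sum_exprqX n f s : is_sum v f s ->
  is_sum v (fun k => f k ^+ (q ^ n)) (s ^+ (q ^ n)).
Proof.
move=> /(abs_cvgP hv) fs; apply/(abs_cvgP hv) => e e0.
(* Below 1, raising to the power [q ^ n] does not increase a value; this gives continuity of the
   iterated Frobenius map. *)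
have e1 : 0 < Num.min e 1 by rewrite lt_min e0 ltr01.
have [N hN] := fs _ e1; exists N => m /hN.
rewrite lt_min -exprqX_sum -exprqXB absvalX// => /andP[h1 h2].
by apply: le_lt_trans h1; rewrite -[leRHS]expr1 ler_wiXn2l// ltW.
Qed.

Lemma fqseriesE c t s :
  is_sum v (fun k => c k * t ^+ (q ^ k)) s -> fqseries v q c t = s.
Proof.
move=> cs; apply: (abs_cvg_unique hv _ cs).
exact: (@xgetPex _ 0 [set s | is_sum v (fun k => c k * t ^+ (q ^ k)) s]%classic
  (ex_intro _ s cs)).
Qed.

Lemma iter_tau j (u : C -> C) t : iter j (tau q) u t = u t ^+ (q ^ j).
Proof.
by elim: j => [|j IHj] //; rewrite iterS {1}/tau IHj -exprM -expnSr.
Qed.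

(* [comp_coef c k m] is the coefficient of [t ^+ (q ^ m)] in the [k]-fold
   composition of [\sum_l c l * t ^+ (q ^ l)] with itself. *)
Fixpoint comp_coef (c : nat -> C) (k m : nat) : C :=
  if k is k'.+1
  then \sum_(l < m.+1) c l * comp_coef c k' (m - l) ^+ (q ^ l)
  else (m == 0)%N%:R.

Lemma comp_coef_lt c k m : c 0%N = 0 -> (m < k)%N -> comp_coef c k m = 0.
Proof.
move=> c0; elim: k m => [|k IHk] m // mk /=.
apply: big1 => -[[|l] lm] _ /=; first by rewrite c0 mul0r.
by rewrite IHk ?expr0qX ?mulr0//; lia.
Qed.

Lemma eq_comp_coef c c' k m : (forall l, (l <= m)%N -> c l = c' l) ->
  comp_coef c k m = comp_coef c' k m.
Proof.
elim: k m => [|k IHk] m cc' //=.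
apply: eq_bigr => -[l lm] _ /=; rewrite cc'// IHk// => i ilm.
by apply: cc'; exact: leq_trans ilm (leq_subr _ _).
Qed.

(** * Growth estimates for the coefficients *)

Variables (A B : R) (a : nat -> nat -> C).
Hypotheses (A_ge1 : 1 <= A) (AB : A <= B).
Hypothesis a_bound :
  forall j k : nat, (1 <= k)%N -> v (a j k) <= A ^+ (k * q ^ j).
Hypothesis a0_bound : forall j : nat, v (a j 0%N) <= A ^+ (q ^ j).

Let A_gt0 : 0 < A. Proof. exact: lt_le_trans ltr01 A_ge1. Qed.
Let A_ge0 : 0 <= A. Proof. exact: ltW. Qed.
Let B_ge1 : 1 <= B. Proof. exact: le_trans A_ge1 AB. Qed.
Let B_gt0 : 0 < B. Proof. exact: lt_le_trans ltr01 B_ge1. Qed.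
Let B_ge0 : 0 <= B. Proof. exact: ltW. Qed.

(** This identity explains the exponent [q ^ l - 1] in all estimates: it is compatible with the
    product [c l * Z ^+ (q ^ l)] occurring in a composition, without any loss. *)
Let predqX_split l m : (l <= m)%N ->
  (q ^ m).-1 = ((q ^ l).-1 + (q ^ (m - l)).-1 * q ^ l)%N.
Proof.
move=> lm; have := qn_gt0 (m - l); have := qn_gt0 l.
have -> : (q ^ m = q ^ (m - l) * q ^ l)%N by rewrite -expnD subnK.
nia.
Qed.

Let predqX_mul_le j m : ((q ^ m).-1 * q ^ j <= (q ^ (m + j)).-1)%N.
Proof.
have := qn_gt0 m; have := qn_gt0 j; rewrite expnD; nia.
Qed.

(** Induction on [k]. In the term of index [l], one factor [A] goes to [c l], and the remaining
    [A ^+ k] is at most its own power of exponent [q ^ l], so it can be moved inside the power;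
    [predqX_split] then recombines the exponents. *)
Lemma comp_coef_bound c n :
  (forall l, (l <= n)%N -> A * v (c l) <= B ^+ (q ^ l).-1) ->
  forall k m, (m <= n)%N -> A ^+ k * v (comp_coef c k m) <= B ^+ (q ^ m).-1.
Proof.
move=> cB; elim=> [|k IHk] m mn.
  rewrite expr0 mul1r /=; case: m mn => [|m] _ /=.
    by rewrite absval1.
  by rewrite absval0// exprn_ge0.
rewrite -ler_pdivlMl ?exprn_gt0//; apply: absval_sum_le => // [|[l lm] _ /=].
  by rewrite mulr_ge0// ?invr_ge0 exprn_ge0.
rewrite ler_pdivlMl ?exprn_gt0// absvalM// absvalX//.
rewrite (predqX_split (l := l))// exprD exprM exprS mulrACA.
apply: ler_pM; rewrite ?mulr_ge0 ?exprn_ge0//.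
  by apply: cB; lia.
apply: le_trans (_ : (A ^+ k * v (comp_coef c k (m - l))) ^+ (q ^ l) <= _).
  rewrite exprMn ler_wpM2r ?exprn_ge0// ler_eXnr//.
  exact: exprn_ege1.
by rewrite lerXn2r ?nnegrE ?mulr_ge0 ?exprn_ge0//; apply: IHk; lia.
Qed.

(** Coefficient of [t ^+ (q ^ (m + j))] in the inner sum over [k] for fixed [j]. When [c 0 = 0],
    truncating at [k = m] loses nothing, by [comp_coef_lt]. *)
Definition rhs_block (c : nat -> C) j m : C :=
  \sum_(k < m.+1) a j k.+1 * comp_coef c k.+1 m ^+ (q ^ j).

Definition rhs_coef (c : nat -> C) n : C :=
  \sum_(j < n.+1) rhs_block c j (n - j) + a n 0%N.

Lemma eq_rhs_coef c c' n : (forall l, (l <= n)%N -> c l = c' l) ->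
  rhs_coef c n = rhs_coef c' n.
Proof.
move=> cc'; congr (_ + _); apply: eq_bigr => -[j jn] _ /=.
apply: eq_bigr => k _; rewrite (@eq_comp_coef c c')// => l lnj.
by apply: cc'; exact: leq_trans lnj (leq_subr _ _).
Qed.

Lemma rhs_term_bound c n :
  (forall l, (l <= n)%N -> A * v (c l) <= B ^+ (q ^ l).-1) ->
  forall j k m, (m <= n)%N ->
  v (a j k.+1 * comp_coef c k.+1 m ^+ (q ^ j)) <= B ^+ (q ^ (m + j)).-1.
Proof.
move=> cB j k m mn; rewrite absvalM// absvalX//.
apply: le_trans (_ : (A ^+ k.+1 * v (comp_coef c k.+1 m)) ^+ (q ^ j) <= _).
  by rewrite exprMn ler_wpM2r ?exprn_ge0// -exprM a_bound.
apply: le_trans (_ : (B ^+ (q ^ m).-1) ^+ (q ^ j) <= _).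
  rewrite lerXn2r ?nnegrE ?mulr_ge0 ?exprn_ge0//.
  exact: comp_coef_bound cB _ _ _.
by rewrite -exprM ler_weXn2l.
Qed.

Lemma rhs_block_bound c n :
  (forall l, (l <= n)%N -> A * v (c l) <= B ^+ (q ^ l).-1) ->
  forall j m, (m <= n)%N -> v (rhs_block c j m) <= B ^+ (q ^ (m + j)).-1.
Proof.
move=> cB j m mn; apply: absval_sum_le => // [|k _]; first exact: exprn_ge0.
exact: rhs_term_bound cB _ _ _ _.
Qed.

(** The maximum keeps two sources apart: the blocks obey the exponent [q ^ n - 1], while the free
    term [a n 0] may reach [A ^+ (q ^ n)], which [A <= B] alone does not bring below the first
    bound. *)
Lemma rhs_coef_bound c n :
  (forall l, (l <= n)%N -> A * v (c l) <= B ^+ (q ^ l).-1) ->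
  v (rhs_coef c n) <= Num.max (B ^+ (q ^ n).-1) (A ^+ (q ^ n)).
Proof.
move=> cB; apply: absvalD_le => //; rewrite le_max; apply/orP; [left|right]=> //.
apply: absval_sum_le => // [|[j jn] _ /=]; first exact: exprn_ge0.
rewrite -{2}(subnK (jn : (j <= n)%N)); apply: rhs_block_bound cB _ _ _; lia.
Qed.

(** Comparison with a geometric series: since [n < q ^ n], the power [(B * v t) ^+ (q ^ n)] is at
    most [(B * v t) ^+ n]. *)
Lemma term_bound u t n : B * v t <= 1 -> v u <= B ^+ (q ^ n) ->
  v (u * t ^+ (q ^ n)) <= (B * v t) ^+ n.
Proof.
move=> t1 uB; rewrite absvalM// absvalX//.
apply: le_trans (_ : (B * v t) ^+ (q ^ n) <= _).
  by rewrite exprMn ler_wpM2r ?exprn_ge0.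
by rewrite ler_wiXn2l ?mulr_ge0// ltnW// ltn_expl.
Qed.

Let predqX_le u n : u <= B ^+ (q ^ n).-1 -> u <= B ^+ (q ^ n).
Proof. by move=> h; apply: le_trans h _; rewrite ler_weXn2l// leq_pred. Qed.

Variable c : nat -> C.
Hypothesis c0 : c 0%N = 0.
Hypothesis cB : forall l, A * v (c l) <= B ^+ (q ^ l).-1.

Let cBn n l : (l <= n)%N -> A * v (c l) <= B ^+ (q ^ l).-1.
Proof. by move=> _; exact: cB. Qed.

Lemma coef_bound l : v (c l) <= B ^+ (q ^ l).
Proof. by apply: predqX_le; apply: le_trans (cB l); rewrite ler_peMl. Qed.

Lemma rhs_coef_le n : v (rhs_coef c n) <= B ^+ (q ^ n).
Proof.
apply: le_trans (rhs_coef_bound (@cBn n)) _; rewrite ge_max predqX_le//=.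
by rewrite lerXn2r// nnegrE.
Qed.

(** * Rearrangement of the multiple series on the disc [B * v t < 1] *)

Section Evaluation.
Variable t : C.
Hypothesis t_small : B * v t < 1.

Let th_itv : 0 <= B * v t < 1.
Proof. by rewrite mulr_ge0. Qed.

Lemma fqseries_sum : is_sum v (fun k => c k * t ^+ (q ^ k)) (fqseries v q c t).
Proof.
have [s hs] : exists s, is_sum v (fun k => c k * t ^+ (q ^ k)) s.
  apply: (is_sum_geometric hv complete th_itv) => n.
  by apply: term_bound; [exact: ltW|exact: coef_bound].
by rewrite (fqseriesE hs).
Qed.

(** Induction on [k]: the expansion of the inner value [y] is raised to the powers [q ^ l] termwise,
    and the resulting triangular double series is summed by columns. The value [v y] is never
    estimated, because [is_sum_triangular] also yields convergence of the outer series at [y]. *)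
Lemma iter_fqseries_sum k :
  is_sum v (fun m => comp_coef c k m * t ^+ (q ^ m))
    (iter k (fqseries v q c) t).
Proof.
elim: k => [|k IHk].
  apply: eq_is_sum (is_sum_single hv t) => -[|m] /=.
    by rewrite mul1r expn0 expr1.
  by rewrite mul0r.
rewrite iterS; set y := iter k _ t in IHk *.
(* Row [l] is the expansion of [c l * y ^+ (q ^ l)], shifted by [l] so that column [n] collects the
   power [t ^+ (q ^ n)]. *)
pose G l n := if (l <= n)%N
  then c l * comp_coef c k (n - l) ^+ (q ^ l) * t ^+ (q ^ n) else 0.
have Gsum l : is_sum v (G l) (c l * y ^+ (q ^ l)).
  have := is_sum_shift hv l (is_sumZ hv (c l) (is_sum_exprqX l IHk)).
  apply: eq_is_sum => n; rewrite /G; case: leqP => // ln.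
  by rewrite exprMn -exprM -expnD subnK// mulrA.
have diagE n : \sum_(l < n.+1) G l n = comp_coef c k.+1 n * t ^+ (q ^ n).
  rewrite /= mulr_suml; apply: eq_bigr => -[l ln] _ /=.
  by rewrite /G -ltnS ln.
have Gth l n : v (G l n) <= (B * v t) ^+ n.
  rewrite /G; case: leqP => ln; last first.
    by rewrite absval0// exprn_ge0// mulr_ge0.
  apply: term_bound; first exact: ltW.
  apply: predqX_le; rewrite (predqX_split ln) exprD exprM absvalM// absvalX//.
  apply: ler_pM; rewrite ?exprn_ge0//.
    by apply: le_trans (cB l); rewrite ler_peMl.
  rewrite lerXn2r ?nnegrE ?exprn_ge0//.
  apply: le_trans (comp_coef_bound (@cBn n) k (leq_subr l n)).
  by rewrite ler_peMl// exprn_ege1.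
have [S hS] : exists S, is_sum v (fun m => comp_coef c k.+1 m * t ^+ (q ^ m)) S.
  apply: (is_sum_geometric hv complete th_itv) => n; rewrite -diagE.
  apply: absval_sum_le => //; rewrite exprn_ge0// mulr_ge0//.
suff -> : fqseries v q c y = S by [].
apply: fqseriesE; apply: (is_sum_triangular hv th_itv Gth _ Gsum).
  by move=> l n nl; rewrite /G leqNgt nl.
by apply: eq_is_sum hS => n; rewrite diagE.
Qed.

(** Two successive rearrangements: for fixed [j], the sum over [k] is regrouped into the blocks;
    then the sum over [j] is regrouped by powers of [t]. *)
Lemma rhs_sum : exists (b : nat -> C) (S S0 : C),
  [/\ forall j, is_sum v (fun k => a j k.+1 *
        iter j (tau q) (iter k.+1 (fqseries v q c)) t) (b j),
      is_sum v b S,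
      is_sum v (fun j => a j 0%N * t ^+ (q ^ j)) S0
    & is_sum v (fun n => rhs_coef c n * t ^+ (q ^ n)) (S + S0)].
Proof.
have [th0 th1] := andP th_itv.
have blockP j : exists bj,
    is_sum v (fun m => rhs_block c j m * t ^+ (q ^ (m + j))) bj /\
    is_sum v (fun k => a j k.+1 *
      iter j (tau q) (iter k.+1 (fqseries v q c)) t) bj.
  have le_th u m : v u <= B ^+ (q ^ (m + j)).-1 ->
      v (u * t ^+ (q ^ (m + j))) <= (B * v t) ^+ m.
    move=> uB; apply: le_trans (term_bound (ltW t_small) (predqX_le uB)) _.
    by rewrite ler_wiXn2l ?leq_addr// ltW.
  have [bj hbj] : exists bj,
      is_sum v (fun m => rhs_block c j m * t ^+ (q ^ (m + j))) bj.
    apply: (is_sum_geometric hv complete th_itv) => m.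
    by apply: le_th; apply: rhs_block_bound (@cBn m) _ _ _.
  exists bj; split=> //.
  (* Row [k] is triangular because a [k.+1]-fold composition starts at [t ^+ (q ^ k.+1)]. *)
  apply: (is_sum_triangular hv th_itv
    (G := fun k m => a j k.+1 * comp_coef c k.+1 m ^+ (q ^ j) *
                     t ^+ (q ^ (m + j)))).
  - by move=> k m; apply: le_th; apply: rhs_term_bound (@cBn m) _ _ _ _.
  - move=> k m mk; have -> : comp_coef c k.+1 m = 0.
      by apply: comp_coef_lt => //; apply: leqW.
    by rewrite expr0qX mulr0 mul0r.
  - move=> k; rewrite iter_tau.
    apply: eq_is_sum (is_sumZ hv _ (is_sum_exprqX j (iter_fqseries_sum k.+1))).
    by move=> m; rewrite exprMn -exprM -expnD mulrA.
  - by apply: eq_is_sum hbj => m; rewrite /rhs_block mulr_suml.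
have [b hb] := choice blockP.
have [S0 hS0] : exists S0, is_sum v (fun j => a j 0%N * t ^+ (q ^ j)) S0.
  apply: (is_sum_geometric hv complete th_itv) => n.
  apply: term_bound; first exact: ltW.
  by apply: le_trans (a0_bound n) _; rewrite lerXn2r// nnegrE.
(* Applying [tau] [j] times moves the block of index [n - j] to the power [t ^+ (q ^ n)]. *)
pose G j n := if (j <= n)%N then rhs_block c j (n - j) * t ^+ (q ^ n) else 0.
have Gth j n : v (G j n) <= (B * v t) ^+ n.
  rewrite /G; case: leqP => jn; last by rewrite absval0// exprn_ge0.
  apply: term_bound; first exact: ltW.
  apply: predqX_le; rewrite -{2}(subnK jn).
  exact: rhs_block_bound (@cBn n) _ _ (leq_subr _ _).
have [S hS] : exists S, is_sum v (fun n => \sum_(j < n.+1) G j n) S.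
  apply: (is_sum_geometric hv complete th_itv) => n.
  by apply: absval_sum_le => //; exact: exprn_ge0.
exists b, S, S0; split=> //.
- by move=> j; case: (hb j).
- apply: (is_sum_triangular hv th_itv Gth) hS.
  + by move=> j n nj; rewrite /G leqNgt nj.
  + move=> j; have [/(is_sum_shift hv j) + _] := hb j.
    by apply: eq_is_sum => n; rewrite /G; case: leqP => // jn; rewrite subnK.
- apply: eq_is_sum (is_sumD hv hS hS0) => n.
  rewrite /rhs_coef mulrDl mulr_suml; congr (_ + _).
  by apply: eq_bigr => -[j jn] _ /=; rewrite /G -ltnS jn.
Qed.

End Evaluation.

Lemma carlitz_Delta_sum x t : v x <= 1 -> B * v t < 1 ->
  is_sum v (fun n => c n * (x ^+ (q ^ n) - x) * t ^+ (q ^ n))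
    (carlitz_Delta x (fqseries v q c) t).
Proof.
move=> x1 t1; have xt1 : B * v (x * t) < 1.
  apply: le_lt_trans t1; rewrite ler_wpM2l// absvalM// ler_piMl//.
have := is_sumB hv (fqseries_sum xt1) (is_sumZ hv x (fqseries_sum t1)).
by apply: eq_is_sum => n; rewrite exprMn; ring.
Qed.

End LinearizedSeries.

(** * The coefficient recursion and its equivalence with the Carlitz equation *)

Section CarlitzEquation.
Variables (R : realType) (C : fieldType) (v : C -> R) (q : nat) (x : C).
Hypothesis hv : nonarch_absval v.
Hypothesis complete : forall s, abs_cauchy v s -> exists l, abs_cvg v s l.
Hypothesis q_gt1 : (1 < q)%N.
Hypothesis exprqD : forall a b : C, (a + b) ^+ q = a ^+ q + b ^+ q.
Hypothesis exprq_surj : forall u : C, exists w, w ^+ q = u.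
Hypothesis x_itv : 0 < v x < 1.

Let v_ge0 a : 0 <= v a. Proof. exact: absval_ge0. Qed.
Hint Resolve v_ge0 : core.
Let x_gt0 : 0 < v x. Proof. by case/andP: x_itv. Qed.
Let x_lt1 : v x < 1. Proof. by case/andP: x_itv. Qed.
Let x_neq0 : x != 0. Proof. by rewrite -(absval_gt0 hv). Qed.

Let x_small (e : R) : 0 < e -> exists N, forall n, (N <= n)%N -> v (x ^+ n) < e.
Proof.
move=> e0; have [|N hN] := @expr_geometric_small R (v x) e _ e0.
  by rewrite (ltW x_gt0) x_lt1.
by exists N => n /hN; rewrite absvalX.
Qed.

Let qX_gt1 n : (1 < q ^ n.+1)%N.
Proof. by apply: leq_trans q_gt1 _; rewrite -{1}[q]expn1 leq_pexp2l// ltnW. Qed.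

(** Injectivity of the Frobenius map leaves [xget] a single candidate. *)
Lemma qroot_exprq (w : C) : qroot q (w ^+ q) = w.
Proof.
apply: (exprq_inj q_gt1 exprqD).
exact: (@xgetPex _ 0 [set u | u ^+ q = w ^+ q]%classic (ex_intro _ w erefl)).
Qed.

Lemma exprq_qroot (u : C) : qroot q u ^+ q = u.
Proof. by have [w <-] := exprq_surj u; rewrite qroot_exprq. Qed.

(* For small [t] the lowest nonzero term would dominate the whole series. *)
Lemma fqseries_eq0 (d : nat -> C) (B r : R) : 1 <= B -> 0 < r ->
  (forall n, v (d n) <= B ^+ (q ^ n)) ->
  (forall t, v t < r -> is_sum v (fun n => d n * t ^+ (q ^ n)) 0) ->
  forall n, d n = 0.
Proof.
move=> B1 r0 dB d0 n; elim/ltn_ind: n => n IHn.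
apply/eqP; rewrite -(absval_eq0 hv); apply: contraT => dn.
have dn0 : 0 < v (d n) by rewrite lt_def dn v_ge0.
have B0 : 0 < B by exact: lt_le_trans ltr01 B1.
have K0 : 0 < B ^+ (q ^ n.+1) by rewrite exprn_gt0.
have Bv0 : 0 < B^-1 by rewrite invr_gt0.
have [N1 h1] := x_small r0; have [N2 h2] := x_small Bv0.
have [N3 h3] := x_small (divr_gt0 dn0 K0).
(* A power of [x] is nonzero and as small as desired. The first two thresholds give convergence and
   decay; the third makes the term of index [n] exceed the bound
   [B ^+ (q ^ n.+1) * v t * v t ^+ (q ^ n)] on the tail. *)
pose t := x ^+ maxn N1 (maxn N2 N3).
have t1 : v t < r by apply: h1; rewrite leq_maxl.
have t2 : v t < B^-1 by apply: h2; rewrite !leq_max leqnn orbT.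
have t3 : v t < v (d n) / B ^+ (q ^ n.+1).
  by apply: h3; rewrite !leq_max leqnn !orbT.
have t0 : 0 < v t by rewrite (absval_gt0 hv) expf_neq0.
have Bt : B * v t <= 1 by rewrite -ler_pdivlMl// mulr1 ltW.
have Bt0 : 0 <= B * v t by rewrite mulr_ge0// ltW.
have tle1 : v t <= 1 by rewrite (le_trans (ltW t2))// invf_le1.
have := is_sum_tail (N := n.+1) (M := (B * v t) ^+ (q ^ n.+1)) hv (d0 t t1).
rewrite big_ord_recr /= big1 ?add0r ?sub0r; last first.
  by move=> [k kn] _ /=; rewrite IHn// mul0r.
rewrite absvalN// absvalM// absvalX// => h.
have {h} : v (d n) * v t ^+ (q ^ n) <= (B * v t) ^+ (q ^ n.+1).
  apply: h => m nm; rewrite absvalM// absvalX//.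
  apply: le_trans (_ : (B * v t) ^+ (q ^ m) <= _).
    by rewrite exprMn ler_wpM2r ?exprn_ge0.
  by rewrite ler_wiXn2l// leq_pexp2l// ltnW.
rewrite exprMn => h.
have h' : v (d n) * v t ^+ (q ^ n) <= B ^+ (q ^ n.+1) * v t * v t ^+ (q ^ n).
  apply: le_trans h _; rewrite -mulrA -exprS ler_wpM2l ?(ltW K0)//.
  by rewrite ler_wiXn2l ?ltn_exp2l// ltW.
rewrite ler_pM2r ?exprn_gt0// in h'.
by move: t3; rewrite ltr_pdivlMr// mulrC ltNge h'.
Qed.

(** Convergence at the single point [x ^+ N] gives [v (c l) <= M * T ^+ (q ^ l)]. For [l >= 1] one
    has [q ^ l <= 2 * (q ^ l - 1)], which accounts for the square of [T]; the index 0 is covered by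
    [c 0 = 0]. *)
Lemma positive_radius_bound (A : R) c : 1 <= A -> c 0%N = 0 ->
  positive_radius v q c ->
  exists2 B, A <= B & forall l, A * v (c l) <= B ^+ (q ^ l).-1.
Proof.
move=> A1 c0 [r r0 hr]; have [N hN] := x_small r0.
have t0 : 0 < v (x ^+ N) by rewrite absval_gt0// expf_neq0.
have t1 : v (x ^+ N) <= 1 by rewrite absvalX// exprn_ile1// ltW.
have [s hs] := hr _ (hN N (leqnn N)).
have [M M1 hM] := is_sum_terms_bounded hv hs.
pose T := (v (x ^+ N))^-1.
have T1 : 1 <= T by rewrite invf_ge1.
have AM1 : 1 <= A * M by rewrite -[1]mulr1 ler_pM.
have A0 : 0 <= A by exact: le_trans ler01 A1.
have AM0 : 0 <= A * M by exact: le_trans ler01 AM1.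
have T0 : 0 <= T by exact: le_trans ler01 T1.
exists (A * M * T ^+ 2).
  rewrite -mulrA ler_peMr// -[1]mulr1 ler_pM//.
  by rewrite exprn_ege1.
case=> [|l].
  by rewrite c0 absval0// mulr0 expn0 expr0.
have [q2 q2'] : (0 < (q ^ l.+1).-1 /\ q ^ l.+1 <= 2 * (q ^ l.+1).-1)%N.
  by move: (qX_gt1 l); clear; lia.
have := hM l.+1; rewrite absvalM// absvalX// -ler_pdivlMr ?exprn_gt0//.
rewrite -exprVn -/T => h.
apply: le_trans (ler_wpM2l A0 h) _; rewrite mulrA exprMn -exprM.
apply: ler_pM; rewrite ?exprn_ge0//.
  by rewrite ler_eXnr.
by rewrite ler_weXn2l.
Qed.

Variables (A : R) (a : nat -> nat -> C).
Hypothesis A_ge1 : 1 <= A.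
Hypothesis a_bound :
  forall j k : nat, (1 <= k)%N -> v (a j k) <= A ^+ (k * q ^ j).
Hypothesis a0_bound : forall j : nat, v (a j 0%N) <= A ^+ (q ^ j).

Let A_gt0 : 0 < A. Proof. exact: lt_le_trans ltr01 A_ge1. Qed.

Definition carlitz_recursion (c : nat -> C) : Prop :=
  forall n, c n.+1 * (x ^+ (q ^ n.+1) - x) = rhs_coef q a c n ^+ q.

(** As [v x < 1], the term [x] dominates. The recursion thus divides by a quantity of constant
    absolute value. *)
Lemma absval_bracket n : v (x ^+ (q ^ n.+1) - x) = v x.
Proof.
rewrite absval_distC// absvalD_eq// absvalN// absvalX//.
rewrite -[ltRHS]expr1 ltr_iXn2l//.
Qed.

Lemma bracket_neq0 n : x ^+ (q ^ n.+1) - x != 0.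
Proof. by rewrite -(absval_gt0 hv) absval_bracket. Qed.

Lemma exists_carlitz_recursion :
  exists2 c, c 0%N = 0 & carlitz_recursion c.
Proof.
have [|c hc] := @fun_rec_exists C 0 (fun n c => if n is m.+1
    then rhs_coef q a c m ^+ q / (x ^+ (q ^ m.+1) - x) else 0).
  by move=> [|m] f g fg //; rewrite (@eq_rhs_coef _ _ _ f g).
exists c; first by rewrite hc.
by move=> n; rewrite hc mulfVK// bracket_neq0.
Qed.

Lemma carlitz_recursion_unique c c' : c 0%N = 0 -> c' 0%N = 0 ->
  carlitz_recursion c -> carlitz_recursion c' -> c = c'.
Proof.
move=> c0 c0' hc hc'; apply/funext => n; elim/ltn_ind: n => -[|n] IHn.
  by rewrite c0 c0'.
apply: (mulIf (bracket_neq0 n)); rewrite hc hc'.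
by rewrite (@eq_rhs_coef _ _ _ c c').
Qed.

Lemma carlitz_recursion_bound c : c 0%N = 0 -> carlitz_recursion c ->
  forall l, A * v (c l) <= (A ^+ 3 / v x) ^+ (q ^ l).-1.
Proof.
move=> c0 hc; set B := A ^+ 3 / v x.
have AB : A <= B.
  rewrite ler_pdivlMr// (le_trans (_ : _ <= A))//.
    by rewrite ler_piMr// ltW.
  by rewrite ler_eXnr.
have B1 : 1 <= B := le_trans A_ge1 AB.
have B0 : 0 <= B := le_trans ler01 B1.
elim/ltn_ind => -[|n] IHn.
  by rewrite c0 absval0// mulr0 expn0 expr0.
have := rhs_coef_bound hv q_gt1 A_ge1 AB a_bound a0_bound
  (IHn : forall l, (l <= n)%N -> _).
set u := v (rhs_coef q a c n) => hu; have u0 : 0 <= u by exact: v_ge0.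
have -> : v (c n.+1) = u ^+ q / v x.
  by rewrite -[u ^+ q]absvalX// -hc absvalM// absval_bracket mulfK// gt_eqF.
have q2 := qX_gt1 n; have qn0 : (0 < q ^ n)%N by rewrite expn_gt0 ltnW.
have qE : (q ^ n.+1 = q ^ n * q)%N by rewrite expnSr.
(* First case, the blocks dominate: [A / v x <= B], and [1 + q * (q ^ n - 1) <= q ^ n.+1 - 1]
   because [q >= 2]. *)
rewrite mulrCA mulrC; move: hu; rewrite le_max => /orP[hu|hu].
  apply: le_trans (_ : B * (B ^+ (q ^ n).-1) ^+ q <= _).
    apply: ler_pM; rewrite ?exprn_ge0// ?divr_ge0//; try exact: ltW.
      by rewrite ler_pM2r ?invr_gt0// ler_eXnr.
    by rewrite lerXn2r// nnegrE// exprn_ge0.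
  by rewrite -exprM -exprS ler_weXn2l// qE; move: q_gt1 qn0; clear; nia.
(* Second case, the free term dominates: two factors [A] are split off to form [B = A ^+ 3 / v x],
   leaving the exponent [q ^ n.+1 - 2]. This is the origin of the cube. *)
apply: le_trans (_ : A / v x * A ^+ (q ^ n.+1) <= _).
  apply: ler_pM; rewrite ?exprn_ge0// ?divr_ge0//; try exact: ltW.
  by rewrite qE exprM lerXn2r// nnegrE exprn_ge0// ltW.
have -> : (q ^ n.+1 = (q ^ n.+1 - 2) + 2)%N by rewrite subnK.
set m := (q ^ n.+1 - 2)%N; rewrite addn2 /= exprS.
have -> : A / v x * A ^+ m.+2 = B * A ^+ m by rewrite /B !exprS expr0; ring.
by rewrite exprS ler_wpM2l// lerXn2r// nnegrE// ltW.
Qed.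

(** By the recursion, [carlitz_Delta] of the series and the [q]-th power of the right-hand side have
    the same expansion; taking [qroot] gives the equation. *)
Lemma carlitz_recursion_solution c : c 0%N = 0 -> carlitz_recursion c ->
  positive_radius v q c /\ carlitz_solution v q x a (fqseries v q c).
Proof.
move=> c0 hc; have cB := carlitz_recursion_bound c0 hc.
set B := A ^+ 3 / v x in cB.
have AB : A <= B.
  rewrite ler_pdivlMr// (le_trans (_ : _ <= A))//.
    by rewrite ler_piMr// ltW.
  by rewrite ler_eXnr.
have B0 : 0 < B := lt_le_trans A_gt0 AB.
have Bv0 : 0 < B^-1 by rewrite invr_gt0.
have small t : v t < B^-1 -> B * v t < 1 by rewrite -ltr_pdivlMl// mulr1.
split; exists B^-1 => // t /small t1.
  by exists (fqseries v q c t); apply: fqseries_sum cB _ t1.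
have [b [S [S0 [hb hS hS0 hT]]]] :=
  rhs_sum hv complete q_gt1 exprqD A_ge1 AB a_bound a0_bound c0 cB t1.
exists b, S, S0; split=> //; rewrite /carlitz_d -[RHS]qroot_exprq; congr qroot.
have hD := carlitz_Delta_sum hv complete q_gt1 A_ge1 AB cB (ltW x_lt1) t1.
apply: (is_sum_unique hv hD).
(* The [q]-th power turns [t ^+ (q ^ n)] into [t ^+ (q ^ n.+1)], hence the shift by one; the vacant
   index 0 matches [c 0 = 0]. *)
have := is_sum_shift hv 1 (is_sum_exprqX hv q_gt1 exprqD 1 hT).
rewrite expn1; apply: eq_is_sum => -[|n] /=; first by rewrite c0 !mul0r.
by rewrite subn1 /= hc exprMn -exprM -expnSr.
Qed.

Lemma carlitz_solution_recursion c : c 0%N = 0 -> positive_radius v q c ->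
  carlitz_solution v q x a (fqseries v q c) -> carlitz_recursion c.
Proof.
move=> c0 /(positive_radius_bound A_ge1 c0) [B AB cB] [r r0 hr].
have B1 : 1 <= B := le_trans A_ge1 AB.
have B0 : 0 < B := lt_le_trans ltr01 B1.
(* Coefficients of [carlitz_Delta] of the series minus the [q]-th power of the right-hand side; this
   series sums to 0 on a small disc, so [fqseries_eq0] applies. *)
pose d n := c n * (x ^+ (q ^ n) - x) -
  (if n is m.+1 then rhs_coef q a c m ^+ q else 0).
suff d0 n : d n = 0.
  by move=> n; apply/eqP; rewrite -subr_eq0 -/(d n.+1) d0.
move: n; apply: (@fqseries_eq0 _ B (Num.min r B^-1)) => //.
- by rewrite lt_min r0 invr_gt0.
- move=> n; apply: absvalB_le => //.
    rewrite absvalM// -[leRHS]mulr1 ler_pM//.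
      exact: (coef_bound hv A_ge1 AB cB).
    by apply: absvalB_le => //; rewrite ?absvalX// ?exprn_ile1// ltW.
  case: n => [|n]; first by rewrite absval0// exprn_ge0// ltW.
  rewrite absvalX// expnSr exprM lerXn2r ?nnegrE ?exprn_ge0//; first exact: ltW.
  exact: (rhs_coef_le hv q_gt1 A_ge1 AB a_bound a0_bound cB).
- move=> t; rewrite lt_min => /andP[/hr [b [S [S0 [hb hS hS0 heq]]]] t1].
  have {}t1 : B * v t < 1 by rewrite -ltr_pdivlMl// mulr1.
  have [b' [S' [S0' [hb' hS' hS0' hT]]]] :=
    rhs_sum hv complete q_gt1 exprqD A_ge1 AB a_bound a0_bound c0 cB t1.
  have bb' : b = b' by apply/funext => j; apply: (is_sum_unique hv (hb j)).
  have SS' : S = S' by apply: (is_sum_unique hv hS); rewrite bb'.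
  have SS0' := is_sum_unique hv hS0 hS0'.
  rewrite -SS' -SS0' -heq in hT.
  have hD := carlitz_Delta_sum hv complete q_gt1 A_ge1 AB cB (ltW x_lt1) t1.
  have := is_sum_shift hv 1 (is_sum_exprqX hv q_gt1 exprqD 1 hT).
  (* Existence of [q]-th roots enters here: it rules out the default value of [qroot], so the
     equation can be raised to the power [q]. *)
  rewrite expn1 exprq_qroot => /(is_sumB hv hD); rewrite subrr.
  apply: eq_is_sum => -[|n] /=; first by rewrite /d c0 !(mul0r, subr0).
  by rewrite /d subn1 /= exprMn -exprM -expnSr mulrBl.
Qed.

End CarlitzEquation.

(** * Laurent series and perfectness of the completion *)

Section LaurentFacts.
Variable F : fieldType.

Lemma laurent_natr n : n%:R = lsingle n%:R 0 :> laurent F.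
Proof.
elim: n => [//|n IHn]; rewrite -natr1 IHn; apply: laurentP => k /=.
by case: eqP => _; rewrite ?addr0// -natr1.
Qed.

Lemma pchar_laurent p : p \in [pchar F] -> p \in [pchar (laurent F)].
Proof.
move=> pF; rewrite inE (pcharf_prime pF) laurent_natr (pcharf0 pF).
exact: eqxx.
Qed.

Lemma lsingleX_neq0 : lsingle (1 : F) 1 != 0.
Proof.
apply/eqP => /(congr1 (fun f : laurent F => f 1)) /= /eqP.
by rewrite oner_eq0.
Qed.

Lemma lorder_lsingleX : lorder (lsingle (1 : F) 1) = 1.
Proof.
have [+ _] := lorderP lsingleX_neq0.
by rewrite /=; case: ifP => [/eqP //|_]; rewrite eqxx.
Qed.

End LaurentFacts.

Lemma labs_lsingleX (R : realType) (F : finFieldType) :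
  labs R (lsingle (1 : F) 1) = #|F|%:R^-1.
Proof. by rewrite /labs (negbTE (lsingleX_neq0 F)) lorder_lsingleX exprN1. Qed.

(** Approximate [u] by elements of [L] and take their [q]-th roots [w n] there. Since
    [vC (a ^+ q - b ^+ q) = vC (a - b) ^+ q], these roots form a Cauchy sequence, and the [q]-th
    power of its limit is [u]. *)
Lemma completion_exprq_surj (R : realType) (L : closedFieldType) (C : fieldType)
    (vL : L -> R) (vC : C -> R) (i : {rmorphism L -> C}) (q : nat) :
  nonarch_absval vC -> completion vL vC i -> (1 < q)%N ->
  (forall a b : C, (a + b) ^+ q = a ^+ q + b ^+ q) ->
  forall u : C, exists w, w ^+ q = u.
Proof.
move=> hv [_ dense complete] q_gt1 exprqD u.
have q0 : (0 < q)%N by exact: ltnW.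
have half : 0 <= (2^-1 : R) < 1 by rewrite invr_ge0 ler0n invf_lt1// ltr1n.
have approx n : exists w : L, vC (i w ^+ q - u) <= 2^-1 ^+ n.
  have [|b hb] := dense u (2^-1 ^+ n); first by rewrite exprn_gt0// invr_gt0.
  have /closed_rootP [w] : size ('X^q - b%:P : {poly L}) != 1%N.
    by rewrite size_XnsubC//; case: (q) q0.
  rewrite /root !hornerE subr_eq0 => /eqP wb.
  by exists w; rewrite -rmorphXn wb absval_distC// ltW.
have [w hw] := choice approx.
have cvg_u : abs_cvg vC (fun n => i (w n) ^+ q) u.
  apply/(abs_cvgP hv) => e e0; have [N hN] := expr_geometric_small half e0.
  by exists N => n /hN; apply: le_lt_trans.
have distq a b : vC (a ^+ q - b ^+ q) = vC (a - b) ^+ q.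
  by rewrite -absvalX// -[in RHS](expn1 q) exprqXB.
have [l hl] : exists l, abs_cvg vC (fun n => i (w n)) l.
  apply: complete => e e0.
  have [N hN] := (abs_cvgP hv _ _).1 cvg_u _ (exprn_gt0 q e0).
  exists N => m n /hN hm /hN hn.
  have : vC (i (w m) ^+ q - i (w n) ^+ q) < e ^+ q.
    have -> : i (w m) ^+ q - i (w n) ^+ q =
      (i (w m) ^+ q - u) + (u - i (w n) ^+ q) by ring.
    by apply: absvalD_lt => //; rewrite absval_distC.
  by rewrite distq ltr_pXn2r ?nnegrE ?absval_ge0// ltW.
exists l; apply: (abs_cvg_unique hv _ cvg_u).
apply/(abs_cvgP hv) => e e0.
have e1 : 0 < Num.min e 1 by rewrite lt_min e0 ltr01.
have [N hN] := (abs_cvgP hv _ _).1 hl _ e1; exists N => n /hN.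
rewrite lt_min distq => /andP[h1 h2]; apply: le_lt_trans h1.
by rewrite -[leRHS]expr1 ler_wiXn2l ?absval_ge0// ltW.
Qed.

Theorem theorem1 (R : realType) (p upsilon q : nat) (Fq : finFieldType)
  (Kbar : closedFieldType) (absKbar : Kbar -> R)
  (iK : {rmorphism laurent Fq -> Kbar})
  (C : fieldType) (absC : C -> R) (iC : {rmorphism Kbar -> C})
  (p_prime : prime p) (upsilon_ge1 : (1 <= upsilon)%N)
  (qE : q = (p ^ upsilon)%N) (card_Fq : #|Fq| = q)
  (iK_closure : algebraic_closure iK)
  (absKbar_val : nonarch_absval absKbar)
  (absKbar_ext : forall f : laurent Fq, absKbar (iK f) = labs R f)
  (absC_val : nonarch_absval absC)
  (iC_completion : completion absKbar absC iC)
  (A : R) (a : nat -> nat -> C) (A_ge1 : 1 <= A)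
  (a_bound : forall j k : nat, (1 <= k)%N -> absC (a j k) <= A ^+ (k * q ^ j))
  (a0_bound : forall j : nat, absC (a j 0%N) <= A ^+ (q ^ j)) :
  exists! c : nat -> C,
    [/\ c 0%N = 0,
        positive_radius absC q c
      & carlitz_solution absC q (iC (iK (lsingle 1 1))) a (fqseries absC q c)].
Proof.
have q_gt1 : (1 < q)%N.
  by rewrite qE -(expn0 p) ltn_exp2l// prime_gt1.
(* The characteristic passes from [Fq] to its Laurent series, then to [C] along [iK] and [iC]. *)
have p_char : p \in [pchar C].
  have pF : p \in [pchar Fq].
    by apply: (@card_finPcharP _ p upsilon); rewrite -?qE.
  rewrite inE p_prime -(rmorph_nat iC) -(rmorph_nat iK).
  by rewrite (pcharf0 (pchar_laurent pF)) !rmorph0 eqxx.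
have exprqD (b d : C) : (b + d) ^+ q = b ^+ q + d ^+ q.
  by rewrite exprDn_pchar// qE pnatX (pnatE _ p_prime) p_char.
have exprq_surj :=
  completion_exprq_surj absC_val iC_completion q_gt1 exprqD.
set x := iC (iK (lsingle 1 1)).
have [iC_abs _ complete] := iC_completion.
have x_itv : 0 < absC x < 1.
  rewrite iC_abs absKbar_ext labs_lsingleX card_Fq invr_gt0 ltr0n.
  have q_gt0 : (0 < q)%N := ltnW q_gt1.
  by rewrite q_gt0 /= invf_lt1 ?ltr0n// ltr1n.
have [c c0 hc] := exists_carlitz_recursion absC_val q_gt1 x_itv a.
exists c; split.
  have [? ?] := carlitz_recursion_solution absC_val complete q_gt1 exprqD x_itv
    A_ge1 a_bound a0_bound c0 hc.
  by split.
move=> c' [c0' rad' sol'].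
apply: (carlitz_recursion_unique absC_val q_gt1 x_itv c0 c0' hc).
exact: (carlitz_solution_recursion absC_val complete q_gt1 exprqD exprq_surj
  x_itv A_ge1 a_bound a0_bound c0' rad' sol').
Qed.
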